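(* Let $(\mathcal{J},\circ)$ be a Euclidean Jordan algebra with underlying vector space $\mathbb{R}^d$, with cone of squares $\mathcal{K}\subseteq\mathbb{R}^d$ and canonical inner product $\langle x,y\rangle=\mathrm{tr}(x\circ y)$. Let $m\ge 1$, let $b_k\in\mathrm{int}(\mathcal{K})$ and $a_1,\dots,a_m\in\mathrm{int}(\mathcal{K})$, and let $\mathcal{A}:\mathbb{R}^d\to\mathbb{R}^m$ be the linear map $\mathcal{A}y=(\langle a_1,y\rangle,\dots,\langle a_m,y\rangle)^{T}$. Let $x\in\mathbb{R}^m$ be fixed, let $f(b)=\frac12\|\mathcal{A}b-x\|_2^2$ for $b\in\mathbb{R}^d$, and define $$u_{b_k}(b)=f(b_k)+\langle b-b_k,\nabla f(b_k)\rangle+\tfrac12\big\langle b-b_k,\;P\big(b_k^{-1}\#(\mathcal{A}^{T}\mathcal{A}b_k)\big)(b-b_k)\big\rangle .$$ Then $$\mathcal{A}^{T}\mathcal{A}\preceq P\big(b_k^{-1}\#(\mathcal{A}^{T}\mathcal{A}b_k)\big).$$ In particular, $f(b)\le u_{b_k}(b)$ for all $b\in\mathbb{R}^d$.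
   Context: A Jordan algebra is a finite-dimensional real vector space $\mathcal{J}$ with a bilinear product $\circ$ satisfying $x\circ y=y\circ x$ and $x^2\circ(x\circ y)=x\circ(x^2\circ y)$, where $x^2=x\circ x$; it is assumed to have an identity element $e$. It is Euclidean (an EJA) if it admits an inner product $(\cdot,\cdot)$ with $(x\circ y,z)=(y,x\circ z)$ for all $x,y,z$. An idempotent is an element $c$ with $c^2=c$; it is primitive if it is nonzero and is not a sum of two nonzero idempotents. A Jordan frame is a family $c_1,\dots,c_r$ of primitive idempotents with $c_i\circ c_j=0$ for $i\ne j$ and $\sum_i c_i=e$. Every $x\in\mathcal{J}$ can be written $x=\sum_{j=1}^r\lambda_jc_j$ for some Jordan frame and reals $\lambda_j$ (the eigenvalues of $x$, unique up to order, counted with multiplicity). One sets $\mathrm{tr}(x)=\sum_j\lambda_j$, and $x^{\alpha}=\sum_j\lambda_j^{\alpha}c_j$ whenever all $\lambda_j^\alpha$ are defined (in particular $x^{-1}$ and $x^{1/2}$). The canonical inner product is $\langle x,y\rangle=\mathrm{tr}(x\circ y)$. The cone of squares is $\mathcal{K}=\{x^2:x\in\mathcal{J}\}$; symmetric cones (self-dual homogeneous cones) are exactly the cones of squares of EJAs. With $L(x)y=x\circ y$, the quadratic representation of $x$ is the linear operator $P(x)=2L(x)^2-L(x^2)$. For $x,y\in\mathrm{int}(\mathcal{K})$ the geometric mean is $x\#y=P(x^{1/2})\big(P(x^{-1/2})y\big)^{1/2}\in\mathrm{int}(\mathcal{K})$. The adjoint $\mathcal{A}^{T}$ and the gradient $\nabla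 f$ are taken with respect to $\langle\cdot,\cdot\rangle$ on $\mathbb{R}^d=\mathcal{J}$ and the standard inner product on $\mathbb{R}^m$; thus $\mathcal{A}^{T}y=\sum_i y_ia_i$ and $\nabla f(b)=\mathcal{A}^{T}(\mathcal{A}b-x)$. For self-adjoint operators, $S\preceq T$ means $\langle b,Sb\rangle\le\langle b,Tb\rangle$ for all $b\in\mathbb{R}^d$. *)

(* Defs.v *)
From HB Require Import structures.
From mathcomp Require Import all_boot all_order all_algebra.
From mathcomp Require Import all_classical all_reals all_analysis.
Set Implicit Arguments.
Unset Strict Implicit.
Unset Printing Implicit Defensive.
Import Order.TTheory GRing.Theory Num.Theory.
Import numFieldNormedType.Exports.
Local Open Scope classical_set_scope.
Local Open Scope ring_scope.

(* Unital real Jordan algebras with underlying space R^d (row vectors).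
   Linearity of the product in its first argument follows from [jprodC]. *)
Record jordan (R : realType) (d : nat) := Jordan {
  jprod : 'rV[R]_d -> 'rV[R]_d -> 'rV[R]_d;
  jone : 'rV[R]_d;
  jprod_linear : forall x, linear (jprod x);
  jprodC : commutative jprod;
  jprod_jordan : forall x y,
    jprod (jprod x x) (jprod x y) = jprod x (jprod (jprod x x) y);
  jprod1l : left_id jone jprod }.

Definition inner_product (R : realType) (d : nat)
    (ip : 'rV[R]_d -> 'rV[R]_d -> R) : Prop :=
  [/\ forall x, scalar (ip x),
      forall x y, ip x y = ip y x &
      forall x, x != 0 -> 0 < ip x x].

Definition euclidean (R : realType) (d : nat) (J : jordan R d) : Prop :=
  exists2 ip : 'rV[R]_d -> 'rV[R]_d -> R, inner_product ip &
    forall x y z, ip (jprod J x y) z = ip y (jprod J x z).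

Section JordanAlgebra.
Context (R : realType) (d : nat) (J : jordan R d).
Implicit Types (x y z c : 'rV[R]_d).

Definition jsq x := jprod J x x.

Definition idempotent c : Prop := jsq c = c.

Definition primitive_idempotent c : Prop :=
  [/\ idempotent c, c != 0 &
      ~ exists c1 c2, [/\ idempotent c1, idempotent c2, c1 != 0, c2 != 0 &
                          c = c1 + c2]].

Definition jordan_frame (r : nat) (c : 'I_r -> 'rV[R]_d) : Prop :=
  [/\ forall i, primitive_idempotent (c i),
      forall i j, i != j -> jprod J (c i) (c j) = 0 &
      \sum_i c i = jone J].

Definition spectral_decomposition x (r : nat) (lam : 'I_r -> R)
    (c : 'I_r -> 'rV[R]_d) : Prop :=
  jordan_frame c /\ x = \sum_j lam j *: c j.

(* In a Euclidean Jordan algebra the sets below are singletons, by existence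
   and uniqueness of the spectral decomposition; the default value of [xget]
   is then irrelevant. *)
Definition jtr x : R :=
  xget 0 [set t | exists r (lam : 'I_r -> R) (c : 'I_r -> 'rV[R]_d),
            spectral_decomposition x lam c /\ t = \sum_j lam j].

Definition jfun (g : R -> R) x : 'rV[R]_d :=
  xget 0 [set y | exists r (lam : 'I_r -> R) (c : 'I_r -> 'rV[R]_d),
            spectral_decomposition x lam c /\ y = \sum_j g (lam j) *: c j].

(* The powers of exponent -1, 1/2 and -1/2. They are meaningful when the
   eigenvalues are respectively nonzero, nonnegative and positive. *)
Definition jinv x := jfun (fun l => l^-1) x.
Definition jsqrt x := jfun (fun l => Num.sqrt l) x.
Definition jinvsqrt x := jfun (fun l => (Num.sqrt l)^-1) x.

Definition jdot x y : R := jtr (jprod J x y).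

Definition jcone : set 'rV[R]_d := range jsq.

Definition jL x y := jprod J x y.

Definition jP x y := 2 *: jL x (jL x y) - jL (jsq x) y.

Definition jgmean x y := jP (jsqrt x) (jsqrt (jP (jinvsqrt x) y)).

Definition loewner_le (S T : 'rV[R]_d -> 'rV[R]_d) : Prop :=
  forall b, jdot b (S b) <= jdot b (T b).

End JordanAlgebra.

(* [`|_|] on matrices is the sup norm, hence an explicit Euclidean structure
   on R^m. *)
Definition dotv (R : realType) (m : nat) (u v : 'rV[R]_m) : R :=
  \sum_i u 0 i * v 0 i.

Section LeastSquares.
Context (R : realType) (d m : nat) (J : jordan R d).

(* The adjoint of B : R^d -> R^m and the (Frechet) gradient of f, for [jdot J]
   on R^d and [dotv] on R^m, as the vectors representing the corresponding
   linear forms. *)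
Definition adjoint (B : 'rV[R]_d -> 'rV[R]_m) (y : 'rV[R]_m) : 'rV[R]_d :=
  xget 0 [set w | forall v, dotv (B v) y = jdot J v w].

Definition gradient (f : 'rV[R]_d -> R) (b : 'rV[R]_d) : 'rV[R]_d :=
  xget 0 [set g | is_diff b f (fun v => jdot J g v)].

Context (a : 'I_m -> 'rV[R]_d) (x : 'rV[R]_m).

Definition meas (y : 'rV[R]_d) : 'rV[R]_m := \row_i jdot J (a i) y.

Definition gram (y : 'rV[R]_d) : 'rV[R]_d := adjoint meas (meas y).

Definition lsq (b : 'rV[R]_d) : R :=
  2^-1 * dotv (meas b - x) (meas b - x).

Definition lsq_majorant (bk b : 'rV[R]_d) : R :=
  lsq bk + jdot J (b - bk) (gradient lsq bk)
  + 2^-1 * jdot J (b - bk)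
             (jP J (jgmean J (jinv J bk) (gram bk)) (b - bk)).

End LeastSquares.

(* Main.v *)
Require Import Defs.
From HB Require Import structures.
From mathcomp Require Import all_boot all_order all_algebra.
From mathcomp Require Import all_classical all_reals all_analysis.
From mathcomp Require Import ring lra.
From mathcomp.real_closed Require complex.
Import Order.TTheory GRing.Theory Num.Theory.
Import numFieldNormedType.Exports.
Local Open Scope classical_set_scope.
Local Open Scope ring_scope.

(** Let [G] be the operator [A^T A] and [w] the geometric mean of [b_k^-1] and
    [G b_k].  The fundamental formula [P (P x y) = P x P y P x] gives
    [P w b_k = G b_k], so [b_k] is a fixed point, interior to the cone, of
    [T = (P w)^-1 G].  Both [G] and [(P w)^-1] preserve the cone, hence the
    powers of [T] preserve every order interval from [-t b_k] to [t b_k], and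
    [<v, P w (T^n v)>] stays bounded in [n].  Since [T] is self-adjoint for the
    positive semidefinite form [<u, P w v>], Cauchy-Schwarz forces
    [<v, G v> = <v, P w (T v)> <= <v, P w v>] (a Perron-Frobenius argument).

    The fundamental formula follows from the derivation identity of the Jordan
    triple product.  The trace is linear because, for any associative inner
    product, two non-orthogonal primitive idempotents have the same norm. *)

Set Implicit Arguments.
Unset Strict Implicit.
Unset Printing Implicit Defensive.

HB.instance Definition _ (R : realType) (d : nat) (J : jordan R d) x :=
  GRing.isLinear.Build R _ _ _ (jprod J x) (jprod_linear J x).

Ltac rv_lra := apply/rowP => i; rewrite !mxE; lra.

(* Orients consistently the products that occur in both orders in the goal. *)
Ltac jcomm := repeat match goal with
  | |- context [jprod ?J ?u ?v] => match goal with
    | |- context [jprod J v u] =>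
        assert_fails (constr_eq u v); rewrite (jprodC J v u) end end.

(** * Polarized Jordan identities and the fundamental formula *)

Section JordanIdentities.
Context (R : realType) (d : nat) (J : jordan R d).
Implicit Types (a b c f s u v w x y z : 'rV[R]_d).

Local Notation "x ∘ y" := (jprod J x y) (at level 40, left associativity).
Local Notation e := (jone J).
Local Notation P := (jP J).

Lemma jprodDr x y z : x ∘ (y + z) = x ∘ y + x ∘ z.
Proof. exact: linearD. Qed.

Lemma jprodNr x y : x ∘ (- y) = - (x ∘ y).
Proof. exact: linearN. Qed.

Lemma jprodBr x y z : x ∘ (y - z) = x ∘ y - x ∘ z.
Proof. exact: linearB. Qed.

Lemma jprodZr k x y : x ∘ (k *: y) = k *: (x ∘ y).
Proof. exact: linearZ. Qed.

Lemma jprod0r x : x ∘ 0 = 0.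
Proof. exact: linear0. Qed.

Lemma jprod_sumr I r (Q : pred I) (F : I -> 'rV[R]_d) x :
  x ∘ (\sum_(i <- r | Q i) F i) = \sum_(i <- r | Q i) x ∘ F i.
Proof. exact: linear_sum. Qed.

Lemma jprodDl x y z : (x + y) ∘ z = x ∘ z + y ∘ z.
Proof. by rewrite jprodC jprodDr /= !(jprodC J z). Qed.

Lemma jprodBl x y z : (x - y) ∘ z = x ∘ z - y ∘ z.
Proof. by rewrite jprodC jprodBr /= !(jprodC J z). Qed.

Lemma jprodZl k x y : (k *: x) ∘ y = k *: (x ∘ y).
Proof. by rewrite jprodC jprodZr /= jprodC. Qed.

Lemma jprod0l x : 0 ∘ x = 0.
Proof. by rewrite jprodC jprod0r. Qed.

Lemma jprod1r x : x ∘ e = x.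
Proof. by rewrite jprodC jprod1l. Qed.

Lemma jprod_suml I r (Q : pred I) (F : I -> 'rV[R]_d) x :
  (\sum_(i <- r | Q i) F i) ∘ x = \sum_(i <- r | Q i) F i ∘ x.
Proof. by rewrite jprodC jprod_sumr; apply: eq_bigr => i _; rewrite /= jprodC. Qed.

(** Polarization: half the difference of the Jordan identities at x + z and x - z, minus the one at
    z, is the part linear in [z]. *)
Let jordan_lin2 x z y :
  2 *: ((x ∘ z) ∘ (x ∘ y)) + (x ∘ x) ∘ (z ∘ y) =
  2 *: (x ∘ ((x ∘ z) ∘ y)) + z ∘ ((x ∘ x) ∘ y).
Proof.
have H k := jprod_jordan J (x + k *: z) y.
have := H 1; have := H (-1); have := jprod_jordan J x y; have := jprod_jordan J z y.
rewrite !(jprodDl, jprodDr, jprodZl, jprodZr) /= !(jprodC J z x).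
move=> /rowP H1 /rowP H2 /rowP H3 /rowP H4; apply/rowP => i.
by move: (H1 i) (H2 i) (H3 i) (H4 i); rewrite !mxE; lra.
Qed.

Lemma jordan_lin a b c y :
  (a ∘ b) ∘ (c ∘ y) + (b ∘ c) ∘ (a ∘ y) + (a ∘ c) ∘ (b ∘ y) =
  c ∘ ((a ∘ b) ∘ y) + a ∘ ((b ∘ c) ∘ y) + b ∘ ((a ∘ c) ∘ y).
Proof.
have := jordan_lin2 (a + b) c y; have := jordan_lin2 a c y.
have := jordan_lin2 b c y.
rewrite !(jprodDl, jprodDr, jprodZl, jprodZr) /= !(jprodC J b a).
move=> /rowP H1 /rowP H2 /rowP H3; apply/rowP => i.
by move: (H1 i) (H2 i) (H3 i); rewrite !mxE; lra.
Qed.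

(** Exchanging [a] and [b] in [jordan_lin] leaves the left side unchanged. Equating the two right
    sides makes the commutator [L(a), L(b)] a derivation. *)
Lemma jprod_der a b x y :
  a ∘ (b ∘ (x ∘ y)) - b ∘ (a ∘ (x ∘ y)) =
  (a ∘ (b ∘ x) - b ∘ (a ∘ x)) ∘ y + x ∘ (a ∘ (b ∘ y) - b ∘ (a ∘ y)).
Proof.
have := jordan_lin a x y b; have := jordan_lin b x y a.
rewrite jprodBl jprodBr; jcomm.
move=> /rowP H1 /rowP H2; apply/rowP => i.
by move: (H1 i) (H2 i); rewrite !mxE; lra.
Qed.

(** Polarized form of [jP], normalized so that the diagonal is [jP] without a factor ([jPE]). *)
Definition jtriple x y z := (x ∘ y) ∘ z + x ∘ (y ∘ z) - y ∘ (x ∘ z).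
Local Notation "{| x , y , z |}" := (jtriple x y z).

Lemma jtripleC x y z : {|x, y, z|} = {|z, y, x|}.
Proof.
by rewrite /jtriple (jprodC J _ z) (jprodC J x (y ∘ z)) (jprodC J x y)
  (jprodC J y z) (jprodC J z x) addrAC [in RHS]addrAC addrC addrA addrAC
  [_ + z ∘ _]addrC.
Qed.

Lemma jPE x y : P x y = {|x, y, x|}.
Proof.
rewrite /jP /jL /jtriple /jsq (jprodC J (x ∘ y)) (jprodC J y x) (jprodC J y).
by rv_lra.
Qed.

Lemma jP_linear x : linear (P x).
Proof.
move=> k y z; rewrite /jP /jL !(jprodDr, jprodZr).
by rv_lra.
Qed.

HB.instance Definition _ x :=
  GRing.isLinear.Build R _ _ _ (jP J x) (jP_linear x).

Lemma jPD x y z : P x (y + z) = P x y + P x z.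
Proof. exact: linearD. Qed.

Lemma jPB x y z : P x (y - z) = P x y - P x z.
Proof. exact: linearB. Qed.

Lemma jPZ x k y : P x (k *: y) = k *: P x y.
Proof. exact: linearZ. Qed.

Lemma jP1 x : P x e = x ∘ x.
Proof. by rewrite /jP /jL /jsq !jprod1r scaler_nat mulr2n addrK. Qed.

Lemma jP_e x : P e x = x.
Proof. by rewrite /jP /jL /jsq !jprod1l scaler_nat mulr2n addrK. Qed.

Lemma jtripleDl x x' y z : {|x + x', y, z|} = {|x, y, z|} + {|x', y, z|}.
Proof.
rewrite /jtriple !(jprodDl, jprodDr) /=.
by rv_lra.
Qed.

Lemma jtripleBm x y y' z : {|x, y - y', z|} = {|x, y, z|} - {|x, y', z|}.
Proof.
rewrite /jtriple !(jprodBl, jprodBr) /=.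
by rv_lra.
Qed.

Lemma jtripleDr x y z z' : {|x, y, z + z'|} = {|x, y, z|} + {|x, y, z'|}.
Proof. by rewrite !(jtripleC x) jtripleDl. Qed.

Lemma jtriple_der a b x y z (D := fun u => a ∘ (b ∘ u) - b ∘ (a ∘ u)) :
  D {|x, y, z|} = {|D x, y, z|} + {|x, D y, z|} + {|x, y, D z|}.
Proof.
have DD u v : D (u + v) = D u + D v.
  by rewrite /D !jprodDr; rv_lra.
have DN u : D (- u) = - D u 
  by rewrite /D !jprodNr; rv_lra.
have DM u v : D (u ∘ v) = D u ∘ v + u ∘ D v by exact: jprod_der.
rewrite /jtriple !DD DN !DM !(jprodDl, jprodDr) /=.
by rv_lra.
Qed.

Lemma jtriple_mul s x y z :
  s ∘ {|x, y, z|} = {|s ∘ x, y, z|} - {|x, s ∘ y, z|} + {|x, y, s ∘ z|}.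
Proof.
have := jordan_lin s x y z; have := jprod_der x y s z.
rewrite /jtriple !(jprodDr, jprodNr, jprodBr, jprodBl); jcomm.
move=> /rowP H1 /rowP H2; apply/rowP => i.
by move: (H1 i) (H2 i); rewrite !mxE; lra.
Qed.

(** The operator [{|a, b, .|}] is L(a ∘ b) + [L(a), L(b)], and exchanging [a] and [b] flips the sign
    of the commutator. [jtriple_mul] treats the multiplication and [jtriple_der] the derivation. *)
Lemma jtriple_id a b x y z :
  {|a, b, {|x, y, z|}|} =
  {|{|a, b, x|}, y, z|} - {|x, {|b, a, y|}, z|} + {|x, y, {|a, b, z|}|}.
Proof.
pose D u := a ∘ (b ∘ u) - b ∘ (a ∘ u).
have trE u : {|a, b, u|} = (a ∘ b) ∘ u + D u by rewrite /jtriple /D; rv_lra.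
have trE' u : {|b, a, u|} = (a ∘ b) ∘ u - D u.
  rewrite /jtriple /D (jprodC J b a).
  by rv_lra.
have DT : D {|x, y, z|} = {|D x, y, z|} + {|x, D y, z|} + {|x, y, D z|}.
  exact: jtriple_der.
rewrite !trE trE' jtripleBm jtripleDl jtripleDr DT jtriple_mul.
by rv_lra.
Qed.

(** Call the three terms p = [{|x, y, P x z|}], q = [{|P x y, z, x|}] and r = [P x {|y, x, z|}]. Two
    instances of the triple identity give p = 2q - r and q = 2p - r, so all three coincide. *)
Lemma jtriple_P1 x y z :
  {|x, y, P x z|} = P x {|y, x, z|} /\ {|x, y, P x z|} = {|P x y, z, x|}.
Proof.
have A := jtriple_id x y x z x; have B := jtriple_id x z x y x.
rewrite (jtripleC {|x, y, x|}) in A.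
rewrite (jtripleC {|x, z, x|}) (jtripleC z x y) in B.
rewrite !jPE (jtripleC {|x, y, x|}).
move/rowP: A => A; move/rowP: B => B.
by split; apply/rowP => i; move: (A i) (B i); rewrite !mxE; lra.
Qed.

(** The term [{|x, y, {|x, y, z|}|}] occurs on both sides of this instance of the triple identity
    and cancels. *)
Lemma jtriple_P2 x y z : {|P x y, y, z|} = {|x, P y x, z|}.
Proof.
have := jtriple_id x y x y z; rewrite !jPE => /rowP A.
by apply/rowP => i; move: (A i); rewrite !mxE; lra.
Qed.

(* Meyberg's derivation of the fundamental formula from the triple identity. *)
Lemma jP_jP x y z : P (P x y) z = P x (P y (P x z)).
Proof.
have [A _] := jtriple_P1 x y z.
have [A' _] := jtriple_P1 x y {|y, x, z|}.
have B := jtriple_id (P x y) z x y x.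
have C := jtriple_id z x y x y.
have zyu : {|z, P x y, y|} = {|P y x, x, z|} by rewrite jtripleC -jtriple_P2.
rewrite -!(jPE x) zyu (jtripleC (P x y) z x) (jtripleC _ z (P x y)) in B.
rewrite -!(jPE y) -(jPE x) (jtripleC z x y) (jtripleC z x) in C.
rewrite (jtripleC {|y, x, z|}) in C.
have [_ D] := jtriple_P1 x y z.
rewrite [LHS]jPE B -D A (jtripleC (P x _)) A' C jPD jPB.
by rv_lra.
Qed.

End JordanIdentities.

(** * Power associativity and systems of orthogonal idempotents *)

Section Powers.
Context (R : realType) (d : nat) (J : jordan R d).
Implicit Types (a b c f s u v w x y z : 'rV[R]_d) (p q : {poly R}).

Local Notation "x ∘ y" := (jprod J x y) (at level 40, left associativity).
Local Notation e := (jone J).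
Local Notation P := (jP J).

(** As an identity of operators in [y], this reduces multiplication by a product of three elements
    to multiplications by shorter products. It drives the induction on powers and several Peirce
    rules. *)
Lemma jprod_op a b f y :
  ((a ∘ b) ∘ f) ∘ y = (a ∘ b) ∘ (f ∘ y) + (a ∘ f) ∘ (b ∘ y)
    + (b ∘ f) ∘ (a ∘ y) - a ∘ (f ∘ (b ∘ y)) - b ∘ (f ∘ (a ∘ y)).
Proof.
have := jordan_lin J a b y f; jcomm => /rowP H; apply/rowP => i.
by move: (H i); rewrite !mxE; lra.
Qed.

Definition jpow x n := iter n (jprod J x) e.

Lemma jpow_comm x n y : jpow x n ∘ (x ∘ y) = x ∘ (jpow x n ∘ y).
Proof.
(* Two consecutive powers are carried because [jprod_op] expresses L(x^(n+2)) through L(x^(n+1)),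
   L(x^n), L(x^2) and L(x). That L(x^2) commutes with L(x) is the Jordan axiom. *)
suff [] : (forall y, jpow x n ∘ (x ∘ y) = x ∘ (jpow x n ∘ y)) /\
  (forall y, jpow x n.+1 ∘ (x ∘ y) = x ∘ (jpow x n.+1 ∘ y)) by [].
elim: n => [|n [IH1 IH2]] {y}.
  by split=> y; rewrite /jpow /= ?jprod1l ?jprod1r.
split=> // y.
have H := jprod_op x (jpow x n) x.
have E : jpow x n.+2 = x ∘ jpow x n ∘ x by rewrite [RHS]jprodC.
rewrite E !H !(jprodC J (jpow x n) x) -!/(jpow x n.+1).
by rewrite !(jprodDr, jprodBr) !IH2 !IH1 jprod_jordan !jprodNr.
Qed.

Definition jeval x p : 'rV[R]_d := \sum_(i < size p) p`_i *: jpow x i.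

Lemma jeval_wide x p n : (size p <= n)%N ->
  jeval x p = \sum_(i < n) p`_i *: jpow x i.
Proof.
move=> pn; rewrite /jeval (big_ord_widen n (fun i => p`_i *: jpow x i)) //.
rewrite big_mkcond /=; apply: eq_bigr => i _.
by case: ltnP => // pi; rewrite nth_default // scale0r.
Qed.

Lemma jeval_linear x : linear (jeval x).
Proof.
move=> k p q; set n := maxn (size p) (size q).
rewrite (@jeval_wide x p n) ?leq_maxl // (@jeval_wide x q n) ?leq_maxr //.
rewrite (@jeval_wide x _ n).
  rewrite scaler_sumr -big_split /=; apply: eq_bigr => i _.
  by rewrite coefD coefZ scalerDl scalerA.
rewrite (leq_trans (size_polyD _ _)) // geq_max leq_maxr andbT.
by rewrite (leq_trans (size_scale_leq _ _)) ?leq_maxl.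
Qed.

HB.instance Definition _ x :=
  GRing.isLinear.Build R _ _ _ (jeval x) (jeval_linear x).

Lemma jevalC x k : jeval x k%:P = k *: e.
Proof.
by rewrite (@jeval_wide x _ 1) ?size_polyC_leq1 // big_ord1 coefC.
Qed.

Lemma jeval1 x : jeval x 1 = e.
Proof. by rewrite -[1]/(1%:P) jevalC scale1r. Qed.

Lemma jevalXM x p : jeval x ('X * p) = x ∘ jeval x p.
Proof.
rewrite (@jeval_wide x _ (size p).+1); last first.
  by rewrite mulrC (leq_trans (size_polyMleq _ _)) // size_polyX addn2.
rewrite big_ord_recl coefXM eqxx scale0r add0r jprod_sumr.
by apply: eq_bigr => i _; rewrite coefXM /= jprodZr.
Qed.

Lemma jevalX x : jeval x 'X = x.
Proof. by rewrite -['X]mulr1 jevalXM jeval1 jprod1r. Qed.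

Lemma jeval_comm x p y : jeval x p ∘ (x ∘ y) = x ∘ (jeval x p ∘ y).
Proof.
rewrite /jeval !jprod_suml jprod_sumr; apply: eq_bigr => i _.
by rewrite !jprodZl jpow_comm jprodZr.
Qed.

(** Power associativity: a factor x is moved out of the product because L(q(x)) commutes with
    L(x). *)
Lemma jevalM x p q : jeval x (p * q) = jeval x p ∘ jeval x q.
Proof.
elim/poly_ind: p => [|p k IH]; first by rewrite mul0r !linear0 jprod0l.
have -> : (p * 'X + k%:P) * q = 'X * (p * q) + k *: q.
  by rewrite -mul_polyC; ring.
rewrite (mulrC p 'X) !linearD linearZ /= !jevalXM IH jevalC jprodDl jprodZl jprod1l.
by congr (_ + _); rewrite (jprodC J (x ∘ _)) jeval_comm (jprodC J (jeval x q)).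
Qed.

(** The first d + 1 powers of [x] are linearly dependent in dimension d. *)
Lemma jeval_annihilated x : exists2 p, p != 0 & jeval x p = 0.
Proof.
pose M := \matrix_(i < d.+1) jpow x i.
have /rowV0Pn [v /sub_kermxP vM v0] : kermx M != 0.
  rewrite -mxrank_eq0 mxrank_ker subn_eq0 -ltnNge ltnS.
  exact: rank_leq_col.
exists (rVpoly v).
  by apply: contra_neq v0 => /(congr1 (poly_rV (d := d.+1))); rewrite rVpolyK linear0.
rewrite (@jeval_wide x _ d.+1) ?size_poly // -[RHS]vM mulmx_sum_row.
by apply: eq_bigr => i _; rewrite coef_rVpoly_ord rowK.
Qed.

(** A frame without primitivity, zero members allowed: the form in which interpolation first
    produces spectral idempotents. *)
Definition orthogonal_idempotents (r : nat) (c : 'I_r -> 'rV[R]_d) :=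
  [/\ forall i, c i ∘ c i = c i, forall i j, i != j -> c i ∘ c j = 0 &
      \sum_i c i = e].

Lemma orthogonal_idempotents_prod r (c : 'I_r -> 'rV[R]_d) (al be : 'I_r -> R) :
  orthogonal_idempotents c ->
  (\sum_i al i *: c i) ∘ (\sum_i be i *: c i) = \sum_i (al i * be i) *: c i.
Proof.
move=> [cc co _]; rewrite jprod_suml; apply: eq_bigr => i _.
rewrite jprod_sumr (bigD1 i) //= big1 ?addr0 => [|j ji].
  by rewrite jprodZl jprodZr cc scalerA.
by rewrite jprodZl jprodZr co 1?eq_sym // !scaler0.
Qed.

Lemma jeval_sum r (c : 'I_r -> 'rV[R]_d) (lam : 'I_r -> R) p :
  orthogonal_idempotents c ->
  jeval (\sum_i lam i *: c i) p = \sum_i p.[lam i] *: c i.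
Proof.
move=> oc; elim/poly_ind: p => [|p k IH].
  by rewrite linear0 big1 // => i _; rewrite horner0 scale0r.
rewrite mulrC linearD /= jevalXM IH jevalC orthogonal_idempotents_prod //.
case: oc => _ _ <-; rewrite scaler_sumr -big_split /=; apply: eq_bigr => i _.
by rewrite hornerD hornerM hornerX hornerC -scalerDl.
Qed.

Lemma orthogonal_idempotents_jP r (c : 'I_r -> 'rV[R]_d) (al be : 'I_r -> R) :
  orthogonal_idempotents c ->
  P (\sum_i al i *: c i) (\sum_i be i *: c i) = \sum_i (al i ^+ 2 * be i) *: c i.
Proof.
move=> oc; rewrite /jP /jL /jsq !orthogonal_idempotents_prod //.
rewrite scaler_sumr -sumrB; apply: eq_bigr => i _.
by rewrite scalerA -scalerBl; congr (_ *: _); ring.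
Qed.

Lemma orthogonal_idempotents_comm r (c : 'I_r -> 'rV[R]_d) (al be : 'I_r -> R) y :
  orthogonal_idempotents c ->
  (\sum_i al i *: c i) ∘ ((\sum_i be i *: c i) ∘ y) =
  (\sum_i be i *: c i) ∘ ((\sum_i al i *: c i) ∘ y).
Proof.
move=> [cc co _].
(* In [jordan_lin] at c i, c i, c j every term containing [c i ∘ c j] vanishes, which leaves the
   commutation. *)
have cij i j : c i ∘ (c j ∘ y) = c j ∘ (c i ∘ y).
  have [->//|ij] := eqVneq i j.
  have := jordan_lin J (c i) (c i) (c j) y.
  rewrite cc (co _ _ ij) !jprod0l !jprod0r !addr0 => H.
  have := jprod_op (c i) (c i) (c j) y; rewrite !cc (co _ _ ij) !jprod0l !addr0.
  by rewrite H.
rewrite !jprod_suml; under eq_bigr do rewrite jprod_sumr.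
rewrite exchange_big /=; apply: eq_bigr => i _.
rewrite jprod_sumr; apply: eq_bigr => j _.
by rewrite !jprodZl !jprodZr cij !scalerA mulrC.
Qed.

End Powers.

(** * Real polynomials: factorization and interpolation *)

Section RealPolynomials.
Import complex.
Context (R : realType).
Implicit Types (p q : {poly R}) (s : seq R).

(** Take a complex root a + ib. If b is nonzero, the real remainder modulo (X - a)^2 + b^2 has
    degree at most one and vanishes there, so it is zero. The sum-of-squares form serves the
    positivity argument of [jeval_real_roots]. *)
Lemma real_poly_factor p : (1 < size p)%N ->
  exists q a b, p = q * (('X - a%:P) ^+ 2 + (b ^+ 2)%:P) /\ b != 0 \/
                p = q * ('X - a%:P).
Proof.
move=> p1; pose f := real_complex R.
have /closed_rootP [[a b] zr] : size (map_poly f p) != 1.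
  by rewrite size_map_poly; case: (size p) p1 => [|[]].
have [b0|b0] := eqVneq b 0.
  have : root p a by rewrite -(fmorph_root f) /f -[_ a]/(Complex a 0) -b0.
  by move=> /factor_theorem [q ->]; exists q, a, 0; right.
exists (p %/ (('X - a%:P) ^+ 2 + (b ^+ 2)%:P)), a, b; left; split=> //.
set m := _ + _.
have ms : size m = 3%N.
  rewrite size_polyDl ?size_exp_XsubC // (leq_ltn_trans (size_polyC_leq1 _)) //.
suff r0 : (p %% m)%R = 0 by rewrite [LHS](divp_eq p m) r0 addr0.
have : (size (p %% m)%R <= 2)%N.
  by rewrite -ltnS -ms ltn_modp -size_poly_eq0 ms.
move: zr; rewrite {1}(divp_eq p m) rmorphD rmorphM /= /root hornerD hornerM.
set r := (p %% m)%R => + rs.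
have -> : r = r`_1 *: 'X + (r`_0)%:P.
  apply/polyP => i; rewrite coefD coefZ coefX coefC.
  case: i => [|[|i]] /=; rewrite ?mulr0 ?mulr1 ?addr0 ?add0r //.
  by rewrite nth_default // (leq_trans rs).
have -> : (map_poly f m).[Complex a b] = 0.
  rewrite /m rmorphD rmorphXn rmorphB /= map_polyX !map_polyC /= !hornerE.
  by apply/eqP; rewrite eq_complex /=; apply/andP; split; apply/eqP; ring.
rewrite mulr0 add0r rmorphD /= map_polyZ /= map_polyX map_polyC /= !hornerE.
rewrite eq_complex /= => /andP[/eqP H1 /eqP H2].
have r1 : r`_1 = 0.
  by apply/eqP; move/eqP: H2; rewrite mul0r addr0 addr0 mulf_eq0 (negPf b0) orbF.
by move: H1; rewrite r1 !mul0r subr0 add0r => ->; rewrite scale0r addr0.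
Qed.

Lemma ltn_size_factor q m p : p != 0 -> p = q * m -> (1 < size m)%N ->
  (size q < size p)%N.
Proof.
move=> p0 E m1; have [q0 m0] : q != 0 /\ m != 0.
  by move: p0; rewrite E mulf_eq0 negb_or => /andP.
rewrite E size_mul //; case: (size m) m1 => [|[|k]] // _.
by rewrite !addnS /= ltnS leq_addr.
Qed.

Lemma poly_interpolation s (g : R -> R) :
  exists p : {poly R}, {in s, forall a, p.[a] = g a}.
Proof.
elim: s => [|a s [p IH]]; first by exists 0.
have [as_|as_] := boolP (a \in s).
  by exists p => b; rewrite inE => /predU1P[->|]; apply: IH.
pose m := \prod_(b <- s) ('X - b%:P).
have ma : m.[a] != 0 by rewrite -[_ == 0]/(root m a) root_prod_XsubC.
exists (p + ((g a - p.[a]) / m.[a]) *: m) => b; rewrite inE hornerD hornerZ.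
have [->|ba /= bs] := eqVneq b a; first by rewrite divfK // subrKC.
by rewrite IH // [m.[b]](rootP _) ?mulr0 ?addr0 // root_prod_XsubC.
Qed.

End RealPolynomials.

(** * Peirce calculus for an idempotent *)

Section Peirce.
Context (R : realType) (d : nat) (J : jordan R d).
Implicit Types (c f u v x y z : 'rV[R]_d).
Local Notation "x ∘ y" := (jprod J x y) (at level 40, left associativity).

Lemma peirce1_prod c u v : c ∘ c = c -> c ∘ u = u -> c ∘ v = v ->
  c ∘ (u ∘ v) = u ∘ v.
Proof.
move=> cc cu cv; have := jordan_lin J c u c v.
rewrite cc (jprodC J u c) !cu !cv => /rowP H; apply/rowP => i.
by move: (H i); rewrite !mxE; lra.
Qed.

Lemma peirce01_prod c u f : c ∘ c = c -> c ∘ u = u -> c ∘ f = 0 -> f ∘ u = 0.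
Proof.
move=> cc cu cf; have H1 := jprod_op J c u f c; have H2 := jordan_lin J c c f u.
have H3 := jprod_op J c c f u.
rewrite !cc !cu cf (jprodC J u c) cu (jprodC J f c) cf !jprod0l !jprod0r in H1 H2 H3.
move: H1 H2 H3; jcomm => /rowP H1 /rowP H2 /rowP H3; apply/rowP => i.
by move: (H1 i) (H2 i) (H3 i); rewrite !mxE; lra.
Qed.

(** For L = L(c), [jprod_op] gives 2L^3 - 3L^2 + L = 0, while P(c) = 2L^2 - L. *)
Lemma jP_peirce1 c z : c ∘ c = c -> c ∘ jP J c z = jP J c z.
Proof.
move=> cc; have := jprod_op J c c c z; rewrite /jP /jL /jsq !cc => /rowP H.
rewrite jprodBr jprodZr; apply/rowP => i.
by move: (H i); rewrite !mxE; lra.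
Qed.

Lemma jP_idem c : c ∘ c = c -> jP J c c = c.
Proof. by move=> cc; rewrite /jP /jL /jsq !cc scaler_nat mulr2n addrK. Qed.

Lemma idempotent_split c c' c'' : c ∘ c = c -> c' ∘ c' = c' -> c'' ∘ c'' = c'' ->
  c = c' + c'' -> c' ∘ c'' = 0.
Proof.
move=> cc cc' cc'' E; move: cc; rewrite E !(jprodDl, jprodDr) cc' cc'' (jprodC J c'' c').
by move=> /rowP H; apply/rowP => i; move: (H i); rewrite !mxE; lra.
Qed.

Lemma jordan_frame_orthogonal r (c : 'I_r -> 'rV[R]_d) :
  jordan_frame J c -> orthogonal_idempotents J c.
Proof. by move=> [cp co c1]; split=> // i; have [] := cp i. Qed.

Lemma orthogonal_idempotents_size r (c : 'I_r -> 'rV[R]_d) :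
  orthogonal_idempotents J c -> (forall i, c i != 0) -> (r <= d)%N.
Proof.
move=> [cc co _] c0; pose M := \matrix_i c i.
suff : row_free M by rewrite /row_free => /eqP <-; exact: rank_leq_col.
apply: inj_row_free => v; rewrite mulmx_sum_row => vM; apply/rowP => j.
have : c j ∘ 0 = v 0 j *: c j.
  rewrite -vM jprod_sumr (bigD1 j) //= rowK jprodZr cc big1 ?addr0 // => i ij.
  by rewrite rowK jprodZr co 1?eq_sym // scaler0.
by rewrite jprod0r mxE => /esym/eqP; rewrite scaler_eq0 (negPf (c0 j)) orbF => /eqP.
Qed.

End Peirce.

(** * Spectral idempotents from an associative inner product *)

Section Spectral.
Context (R : realType) (d : nat) (J : jordan R d).
Context (ip : 'rV[R]_d -> 'rV[R]_d -> R) (hip : inner_product ip).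
Context (ipA : forall x y z, ip (jprod J x y) z = ip y (jprod J x z)).
Implicit Types (c f u v x y z : 'rV[R]_d) (p q h : {poly R}).
Local Notation "x ∘ y" := (jprod J x y) (at level 40, left associativity).
Local Notation e := (jone J).
Local Notation P := (jP J).

Lemma ipC x y : ip x y = ip y x. Proof. by case: hip. Qed.

Lemma ipDr x y z : ip x (y + z) = ip x y + ip x z.
Proof. by case: hip => /(_ x 1 y z); rewrite scale1r mul1r. Qed.

Lemma ip0r x : ip x 0 = 0.
Proof. by have := ipDr x 0 0; rewrite addr0 => /eqP; rewrite -subr_eq subrr => /eqP. Qed.

Lemma ipZr k x y : ip x (k *: y) = k * ip x y.
Proof. by case: hip => /(_ x k y 0); rewrite !addr0 ip0r addr0. Qed.

Lemma ipDl x y z : ip (x + y) z = ip x z + ip y z.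
Proof. by rewrite !(ipC _ z) ipDr. Qed.

Lemma ipZl k x y : ip (k *: x) y = k * ip x y.
Proof. by rewrite !(ipC _ y) ipZr. Qed.

Lemma ipNr x y : ip x (- y) = - ip x y.
Proof. by rewrite -scaleN1r ipZr mulN1r. Qed.

Lemma ipBr x y z : ip x (y - z) = ip x y - ip x z.
Proof. by rewrite ipDr ipNr. Qed.

Lemma ipBl x y z : ip (x - y) z = ip x z - ip y z.
Proof. by rewrite !(ipC _ z) ipBr. Qed.

Lemma ip_sumr I (r : seq I) (Q : pred I) (F : I -> 'rV[R]_d) x :
  ip x (\sum_(i <- r | Q i) F i) = \sum_(i <- r | Q i) ip x (F i).
Proof. by apply: (big_morph (ip x)); [exact: ipDr | exact: ip0r]. Qed.

Lemma ip_suml I (r : seq I) (Q : pred I) (F : I -> 'rV[R]_d) x :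
  ip (\sum_(i <- r | Q i) F i) x = \sum_(i <- r | Q i) ip (F i) x.
Proof. by rewrite ipC ip_sumr; apply: eq_bigr => i _; rewrite ipC. Qed.

Lemma ip_ge0 x : 0 <= ip x x.
Proof.
have [->|x0] := eqVneq x 0; first by rewrite ip0r.
by apply: ltW; case: hip => _ _; apply.
Qed.

Lemma ip_eq0 x : ip x x = 0 -> x = 0.
Proof.
move=> xx; apply/eqP/negPn/negP => x0; case: hip => _ _ /(_ x x0).
by rewrite xx ltxx.
Qed.

Lemma ip_inj x y : (forall z, ip x z = ip y z) -> x = y.
Proof. by move=> H; apply/subr0_eq/ip_eq0; rewrite ipBl H subrr. Qed.

Lemma jsq_eq0 x : x ∘ x = 0 -> x = 0.
Proof.
by move=> xx; apply: ip_eq0; rewrite -{1}(jprod1r J x) ipA xx ip0r.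
Qed.

Lemma ip_jP x y z : ip (P x y) z = ip y (P x z).
Proof. by rewrite /jP /jL !(ipBl, ipBr, ipZl, ipZr) !ipA. Qed.

Lemma jeval_real_roots x p h : p != 0 -> jeval J x (p * h) = 0 ->
  exists2 s : seq R, uniq s & jeval J x (\prod_(a <- s) ('X - a%:P) * h) = 0.
Proof.
move: {2}(size p) (leqnn (size p)) => n.
elim: n p h => [|n IH] p h pn p0; first by rewrite leqn0 size_poly_eq0 (negPf p0) in pn.
have [p1|p1] := leqP (size p) 1.
  have /size_poly1P [k k0 ->] : size p == 1%N by rewrite eqn_leq p1 size_poly_gt0.
  rewrite mul_polyC linearZ /= => /eqP; rewrite scaler_eq0 (negPf k0) => /eqP H.
  by exists [::]; rewrite // big_nil mul1r.
have [q [a [b [[Ep b0]|Ep]]]] := real_poly_factor p1.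
  set m := _ + _ in Ep; rewrite Ep -mulrA => /IH [].
  - rewrite -ltnS (leq_trans _ pn) // (@ltn_size_factor _ q m p) //.
    by rewrite size_polyDl size_exp_XsubC // (leq_ltn_trans (size_polyC_leq1 _)).
  - by apply: contraNneq p0 => q0; rewrite Ep q0 mul0r.
  move=> s us; set u := jeval J x (\prod_(a <- s) ('X - a%:P) * h) => H.
  exists s => //; rewrite -/u; apply: ip_eq0.
  have XB w : jeval J x (('X - a%:P) * w) = x ∘ jeval J x w - a *: jeval J x w.
    by rewrite mulrBl mul_polyC linearB linearZ /= jevalXM.
  have bz : jeval J x (b ^+ 2 *: (\prod_(a <- s) ('X - a%:P) * h)) = b ^+ 2 *: u.
    by rewrite linearZ.
  set v := x ∘ u - a *: u.
  have E : x ∘ v - a *: v + b ^+ 2 *: u = 0.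
    rewrite -H mulrCA /m mulrDl mul_polyC (linearD (jeval J x)) /= bz expr2 -mulrA !XB.
    by rewrite -/u -/v.
  have : ip u (x ∘ v - a *: v + b ^+ 2 *: u) = ip v v + b ^+ 2 * ip u u.
    by rewrite [in RHS]/v ipBl ipZl ipA -/v ipDr ipBr !ipZr.
  rewrite E ip0r => /esym /eqP.
  rewrite paddr_eq0 ?ip_ge0 ?(mulr_ge0 (sqr_ge0 b) (ip_ge0 u)) //.
  by rewrite mulf_eq0 sqrf_eq0 (negPf b0) /= => /andP[_ /eqP].
rewrite Ep -mulrA => /IH [].
- rewrite -ltnS (leq_trans _ pn) // (@ltn_size_factor _ q ('X - a%:P) p) //.
  by rewrite size_XsubC.
- by apply: contraNneq p0 => q0; rewrite Ep q0 mul0r.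
move=> s us H; have [as_|as_] := boolP (a \in s); last first.
  by exists (a :: s); rewrite /= ?as_ ?us // big_cons -mulrA mulrCA.
exists s => //; apply: jsq_eq0; rewrite -jevalM.
move: H; rewrite (perm_big _ (perm_to_rem as_)) big_cons /=.
set g := \prod_(_ <- _) _ => H.
have -> : ('X - a%:P) * g * h * (('X - a%:P) * g * h) =
  ('X - a%:P) * g * (('X - a%:P) * h) * (g * h) by ring.
by rewrite jevalM H jprod0l.
Qed.

Lemma spectral_idempotents x : exists r (lam : 'I_r -> R) (l : 'I_r -> {poly R}),
  orthogonal_idempotents J (fun i => jeval J x (l i)) /\
  x = \sum_i lam i *: jeval J x (l i).
Proof.
have [p p0 xp] := jeval_annihilated J x.
have [|s us xs] := @jeval_real_roots x p 1 p0; first by rewrite mulr1.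
rewrite mulr1 in xs.
(* Evaluation at [x] sees only the values on [s], so the relations between the Lagrange polynomials
   [l i] below need only be checked at the roots. *)
have jev q q' : {in s, forall a, q.[a] = q'.[a]} -> jeval J x q = jeval J x q'.
  move=> qq'; apply/eqP; rewrite -subr_eq0 -linearB /=.
  have rt : all (root (q - q')) s.
    by apply/allP => a /qq' E; rewrite /root hornerD hornerN E subrr.
  have [|g ->] := uniq_roots_prod_XsubC rt; first by rewrite uniq_rootsE.
  by rewrite jevalM xs jprod0r.
pose r := size s; pose lam (i : 'I_r) := s`_i.
have ex i : exists q : {poly R}, {in s, forall a, q.[a] = (a == lam i)%:R}.
  exact: (poly_interpolation s (fun a => (a == lam i)%:R)).
have [l lE] := choice ex.
have sumE (g : R -> R) a : a \in s -> \sum_i g (lam i) * (l i).[a] = g a.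
  move=> as_; have ia : (index a s < r)%N by rewrite index_mem.
  rewrite (bigD1 (Ordinal ia)) //= lE // /lam /= nth_index // eqxx mulr1.
  rewrite big1 ?addr0 // => i; rewrite -val_eqE /= lE // => ii.
  have [E|] := eqVneq a (s`_i); last by rewrite mulr0.
  by move: ii; rewrite E index_uniq ?eqxx.
exists r, lam, l; split; last first.
  have -> : \sum_i lam i *: jeval J x (l i) = jeval J x (\sum_i lam i *: l i).
    by rewrite linear_sum; apply: eq_bigr => i _; rewrite linearZ.
  rewrite -{1}(jevalX J x); apply: jev => a as_.
  rewrite hornerX horner_sum -{1}(sumE id a as_).
  by apply: eq_bigr => i _; rewrite hornerZ.
split=> [i|i j ij|].
- rewrite -jevalM; apply: jev => a as_; rewrite hornerM !lE //.
  by case: eqP; rewrite ?mulr1 ?mulr0.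
- rewrite -jevalM -(linear0 (jeval J x)); apply: jev => a as_.
  rewrite hornerM !lE // horner0.
  case: eqP => [->|_]; last by rewrite mul0r.
  case: eqP => [/eqP|_]; last by rewrite mulr0.
  by rewrite /lam nth_uniq // val_eqE (negPf ij).
- rewrite -linear_sum -(jeval1 J x); apply: jev => a as_.
  rewrite horner_sum hornerC -[RHS](sumE (fun=> 1) a as_).
  by apply: eq_bigr => i _; rewrite mul1r.
Qed.

End Spectral.

(** * Jordan frames, functional calculus and the trace *)

Section Frames.
Context (R : realType) (d : nat) (J : jordan R d).
Context (ip : 'rV[R]_d -> 'rV[R]_d -> R) (hip : inner_product ip).
Context (ipA : forall x y z, ip (jprod J x y) z = ip y (jprod J x z)).
Implicit Types (c f u v x y z : 'rV[R]_d) (p q h : {poly R}).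
Local Notation "x ∘ y" := (jprod J x y) (at level 40, left associativity).
Local Notation e := (jone J).
Local Notation P := (jP J).

Lemma drop_zero_idempotents r (lam : 'I_r -> R) (c : 'I_r -> 'rV[R]_d) :
  orthogonal_idempotents J c ->
  exists r' (lam' : 'I_r' -> R) (c' : 'I_r' -> 'rV[R]_d),
  [/\ orthogonal_idempotents J c', forall i, c' i != 0 &
      \sum_i lam i *: c i = \sum_i lam' i *: c' i].
Proof.
elim: r lam c => [|r IH] lam c oc; first by exists 0, lam, c; split=> // -[].
have [/existsP [i /eqP ci0]|] := boolP [exists i, c i == 0]; last first.
  by rewrite negb_exists => /forallP c0; exists r.+1, lam, c.
have [|r' [lam' [c' [oc' c0' E]]]] := IH (lam \o lift i) (c \o lift i).
  case: oc => cc co c1; split=> /= [j|j k jk|]; first exact: cc.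
    by rewrite co // (inj_eq lift_inj).
  by rewrite -c1 (bigD1_ord i) //= ci0 add0r.
exists r', lam', c'; split=> //.
by rewrite (bigD1_ord i) //= ci0 scaler0 add0r -E.
Qed.

(** Splitting a non-primitive member raises [r], which linear independence bounds by [d]; hence the
    induction on [d - r]. *)
Lemma frame_of_idempotents r (lam : 'I_r -> R) (c : 'I_r -> 'rV[R]_d) :
  orthogonal_idempotents J c -> (forall i, c i != 0) ->
  exists r' (lam' : 'I_r' -> R) (c' : 'I_r' -> 'rV[R]_d),
  jordan_frame J c' /\ \sum_i lam i *: c i = \sum_i lam' i *: c' i.
Proof.
have [n] := ubnP (d - r)%N; elim: n r lam c => // n IH r lam c rn oc c0.
have [cc co c1] := oc.
have [cp|/existsNP [i ncp]] := pselect (forall i, primitive_idempotent J (c i)).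
  by exists r, lam, c.
have [u [v [uu vv u0 v0 cuv]]] : exists u v, [/\ u ∘ u = u,
    v ∘ v = v, u != 0, v != 0 & c i = u + v].
  by apply: contrapT => H; apply: ncp; split=> //; exact: cc.
have uv : u ∘ v = 0 by exact: idempotent_split (cc i) uu vv cuv.
have cu : c i ∘ u = u by rewrite cuv jprodDl uu (jprodC J v) uv addr0.
have cv : c i ∘ v = v by rewrite cuv jprodDl uv vv add0r.
have cju j : j != i -> c j ∘ u = 0.
  by move=> ji; apply: (peirce01_prod (cc i) cu); rewrite co // eq_sym.
have cjv j : j != i -> c j ∘ v = 0.
  by move=> ji; apply: (peirce01_prod (cc i) cv); rewrite co // eq_sym.
(* The refined system [f] has [u] in place of [c i] and [v] as new member 0, both with eigenvalue
   [lam i]. *)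
pose c' j := if j == i then u else c j.
pose f k := if unlift ord0 k is Some j then c' j else v.
pose lam' k := if unlift ord0 k is Some j then lam j else lam i.
have fS (g : 'I_r.+1 -> R) : \sum_k g k *: f k =
    g ord0 *: v + \sum_j g (lift ord0 j) *: c' j.
  rewrite big_ord_recl /f unlift_none; congr (_ + _).
  by apply: eq_bigr => j _; rewrite liftK.
have cS (g : 'I_r -> R) : g i *: v + \sum_j g j *: c' j = \sum_j g j *: c j.
  rewrite (bigD1 i) //= [RHS](bigD1 i) //= /c' eqxx cuv scalerDr addrA.
  rewrite [_ + g i *: u]addrC; congr (_ + _).
  by apply: eq_bigr => j /negPf ->.
have of' : orthogonal_idempotents J f.
  split=> [k|k l|].
  - rewrite /f; case: unliftP => [j _|_]; last exact: vv.
    by rewrite /c'; case: (j == i); [exact: uu|exact: cc].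
  - rewrite /f; case: unliftP => [j ->|->]; case: unliftP => [j' ->|->] //.
    + rewrite (inj_eq lift_inj) /c'; have [->|ji] := eqVneq j i.
        by rewrite eq_sym => /negPf E; rewrite E jprodC cju // E.
      by have [->|j'i] := eqVneq j' i => // jj'; rewrite ?cju ?co.
    + by move=> _; rewrite /c'; case: eqVneq => // ji; rewrite cjv.
    + by move=> _; rewrite /c' jprodC; case: eqVneq => // ji; rewrite cjv.
  - have -> : \sum_k f k = \sum_k 1 *: f k.
      by apply: eq_bigr => k _; rewrite scale1r.
    by rewrite fS (cS (fun=> 1)) -c1; apply: eq_bigr => j _; rewrite scale1r.
have f0 k : f k != 0.
  by rewrite /f; case: unliftP => // j _; rewrite /c'; case: (j == i).
have rd := orthogonal_idempotents_size of' f0.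
have [|r' [mu [g [fg E]]]] := IH r.+1 lam' f _ of' f0.
  by rewrite -ltnS (leq_trans _ rn) // ltnS ltn_sub2l.
exists r', mu, g; split=> //; rewrite -E fS -cS /lam' unlift_none.
by congr (_ + _); apply: eq_bigr => j _; rewrite liftK.
Qed.

Lemma spectral_theorem x : exists r (lam : 'I_r -> R) (c : 'I_r -> 'rV[R]_d),
  spectral_decomposition J x lam c.
Proof.
have [r [lam [l [oc ->]]]] := spectral_idempotents hip ipA x.
have [r' [lam' [c' [oc' c0' ->]]]] := drop_zero_idempotents lam oc.
have [r2 [mu [f [ff ->]]]] := frame_of_idempotents lam' oc' c0'.
by exists r2, mu, f.
Qed.

(** Independence of the decomposition: one polynomial interpolates [g] on the eigenvalues of two
    decompositions, and both sums are its value at [x]. *)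
Lemma jfunE (g : R -> R) x r (lam : 'I_r -> R) (c : 'I_r -> 'rV[R]_d) :
  spectral_decomposition J x lam c -> jfun J g x = \sum_j g (lam j) *: c j.
Proof.
move=> xlc; apply: xget_unique; first by exists r, lam, c.
move=> _ [s [mu [f [[ff Ef] ->]]]]; have [fc Ec] := xlc.
have [p pE] := poly_interpolation (codom lam ++ codom mu) g.
have pj n (nu : 'I_n -> R) (b : 'I_n -> 'rV[R]_d) : jordan_frame J b ->
    x = \sum_j nu j *: b j -> {subset codom nu <= codom lam ++ codom mu} ->
    \sum_j g (nu j) *: b j = jeval J x p.
  move=> fb -> sub; rewrite jeval_sum; last exact: jordan_frame_orthogonal.
  by apply: eq_bigr => j _; rewrite pE // sub // codom_f.
rewrite (pj _ _ _ ff Ef) ?(pj _ _ _ fc Ec) // => a;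
  by rewrite mem_cat => ->; rewrite ?orbT.
Qed.

Lemma primitive_idem c : primitive_idempotent J c -> c ∘ c = c /\ c != 0.
Proof. by case. Qed.

(** Each spectral idempotent of [u] with nonzero eigenvalue is fixed by L(c). It is therefore 0 or
    c, since otherwise it would split c. *)
Lemma primitive_line c u : primitive_idempotent J c -> c ∘ u = u ->
  exists k, u = k *: c.
Proof.
move=> cp cu; have [cc c0] := primitive_idem cp; have [_ _ cprim] := cp.
have cpow n : c ∘ jpow J u n.+1 = jpow J u n.+1.
  elim: n => [|n IH]; first by rewrite /jpow /= jprod1r.
  exact: peirce1_prod cc cu IH.
have ceval p : c ∘ (u ∘ jeval J u p) = u ∘ jeval J u p.
  rewrite !jprod_sumr; apply: eq_bigr => i _; rewrite !jprodZr.
  by congr (_ *: _); exact: cpow.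
have [r [lam [l [oc Eu]]]] := spectral_idempotents hip ipA u.
set f := fun i => jeval J u (l i) in oc Eu; have [ff fo _] := oc.
exists (\sum_(i | f i == c) lam i).
rewrite [LHS]Eu scaler_suml [RHS]big_mkcond /=; apply: eq_bigr => i _.
rewrite -/(f i); have [-> //|fc] := eqVneq (f i) c.
have [->|l0] := eqVneq (lam i) 0; first by rewrite scale0r.
have ufi : u ∘ f i = lam i *: f i.
  rewrite {1}Eu jprod_suml (bigD1 i) //= jprodZl ff big1 ?addr0 // => j ji.
  by rewrite jprodZl fo // scaler0.
have cfi : c ∘ f i = f i.
  have := ceval (l i); rewrite -/(f i) ufi jprodZr => H.
  by apply: (scalerI l0).
have [->|fi0] := eqVneq (f i) 0; first by rewrite scaler0.
case: cprim; exists (f i), (c - f i); split=> //; first exact: ff.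
- by rewrite /Defs.idempotent /jsq jprodBl !jprodBr cc (jprodC J _ c) cfi ff subrr subr0.
- by rewrite subr_eq0 eq_sym.
- by rewrite addrC subrK.
Qed.

Lemma primitive_jP c z : primitive_idempotent J c -> exists k, P c z = k *: c.
Proof.
by move=> cp; apply: (primitive_line cp); apply: jP_peirce1; case: cp.
Qed.

(* Evaluating the fundamental formula for [P (P c c')] at the unit compares the
   coefficients in [P c c' = k c] and [P c' c = k' c']. *)
Lemma primitive_norm c c' : primitive_idempotent J c ->
  primitive_idempotent J c' -> ip c c' != 0 -> ip c c = ip c' c'.
Proof.
move=> cp cp' cc'0.
have [cc c0] := primitive_idem cp; have [cc' c0'] := primitive_idem cp'.
have [k Ek] := primitive_jP c' cp; have [k' Ek'] := primitive_jP c cp'.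
have H : k * ip c c = ip c c'.
  by rewrite -(ipZl hip) -Ek (ip_jP hip ipA) jP_idem // (ipC hip).
have H' : k' * ip c' c' = ip c c'.
  by rewrite -(ipZl hip) -Ek' (ip_jP hip ipA) jP_idem.
have k0 : k != 0 by apply: contraNneq cc'0 => k0; rewrite -H k0 mul0r.
have kk' : k = k'.
  have := jP_jP J c c' e; rewrite !jP1 cc Ek Ek' jprodZl jprodZr cc jPZ Ek.
  rewrite !scalerA => /eqP; rewrite -subr_eq0 -scalerBl scaler_eq0 (negPf c0) orbF.
  by rewrite -mulrBl mulf_eq0 (negPf k0) orbF subr_eq0 => /eqP.
by apply: (mulfI k0); rewrite H kk' H'.
Qed.

(** The linear form [tau] is 1 on each primitive idempotent c: by [primitive_norm] the denominators
    can be replaced by [ip c c], and the sum becomes [ip c e / ip c c]. So [tau x] is the sum of the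
    eigenvalues in any decomposition. *)
Lemma jtr_frame s (f : 'I_s -> 'rV[R]_d) : jordan_frame J f ->
  forall x, jtr J x = \sum_i ip x (f i) / ip (f i) (f i).
Proof.
move=> [fp fo f1] x; pose tau y := \sum_i ip y (f i) / ip (f i) (f i).
have tau1 c : primitive_idempotent J c -> tau c = 1.
  move=> cp; have [cc c0] := primitive_idem cp.
  have -> : tau c = \sum_i ip c (f i) / ip c c.
    apply: eq_bigr => i _; have [->|cf] := eqVneq (ip c (f i)) 0.
      by rewrite !mul0r.
    by rewrite (primitive_norm cp (fp i) cf).
  rewrite -mulr_suml -(ip_sumr hip) f1.
  have -> : ip c e = ip c c by rewrite -[in LHS]cc ipA jprod1r.
  by rewrite divff //; apply: contra_neq c0; exact: (ip_eq0 hip).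
have [r [lam [c [fc Ex]]]] := spectral_theorem x.
have tauE n (mu : 'I_n -> R) (b : 'I_n -> 'rV[R]_d) : jordan_frame J b ->
    x = \sum_j mu j *: b j -> \sum_j mu j = tau x.
  move=> [bp _ _] ->; rewrite /tau.
  under [RHS]eq_bigr do rewrite (ip_suml hip) mulr_suml.
  rewrite exchange_big; apply: eq_bigr => j _ /=.
  rewrite -[LHS]mulr1 -(tau1 _ (bp j)) mulr_sumr; apply: eq_bigr => i _.
  by rewrite (ipZl hip) mulrA.
apply: xget_unique.
  by exists r, lam, c; split=> //; rewrite (tauE _ lam c).
by move=> _ [n [mu [b [[fb Eb] ->]]]]; rewrite (tauE _ mu b).
Qed.

Lemma ip_orthogonal c c' : c ∘ c = c -> c ∘ c' = 0 -> ip c c' = 0.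
Proof. by move=> cc cc'; rewrite -cc ipA cc' (ip0r hip). Qed.

Lemma jtr_sum r (lam : 'I_r -> R) (c : 'I_r -> 'rV[R]_d) : jordan_frame J c ->
  jtr J (\sum_i lam i *: c i) = \sum_i lam i.
Proof.
move=> fc; have [cp co _] := fc; rewrite (jtr_frame fc); apply: eq_bigr => i _.
have [ci ci0] := primitive_idem (cp i).
rewrite (ip_suml hip) (bigD1 i) //= big1 ?addr0 => [|j ji].
  by rewrite (ipZl hip) mulfK //; apply: contra_neq ci0; exact: (ip_eq0 hip).
have [cj _] := primitive_idem (cp j).
by rewrite (ipZl hip) ip_orthogonal ?mulr0 // co.
Qed.

(** The vector that represents the trace for [ip]. *)
Definition frame_dual s (f : 'I_s -> 'rV[R]_d) := \sum_i (ip (f i) (f i))^-1 *: f i.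

Lemma jtr_frame_dual s (f : 'I_s -> 'rV[R]_d) : jordan_frame J f ->
  forall x, jtr J x = ip x (frame_dual f).
Proof.
move=> ff x; rewrite (jtr_frame ff) (ip_sumr hip); apply: eq_bigr => i _.
by rewrite (ipZr hip) mulrC.
Qed.

(** Allows everything proved for an arbitrary associative [ip] to be applied to [jdot]. *)
Lemma jdot_euclidean : inner_product (jdot J) /\
  forall x y z, jdot J (x ∘ y) z = jdot J y (x ∘ z).
Proof.
have [s [_ [f [ff _]]]] := spectral_theorem e.
have trE := jtr_frame_dual ff; set t := frame_dual f in trE.
(* All frames have the same dual element, so [t] operator-commutes with every
   element of the algebra. *)
have tcomm y z : y ∘ (t ∘ z) = t ∘ (y ∘ z).
  have [r [lam [c [fc ->]]]] := spectral_theorem y.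
  have -> : t = frame_dual c.
    by apply: (ip_inj hip) => u; rewrite !(ipC hip _ u) -trE (jtr_frame_dual fc).
  by apply: orthogonal_idempotents_comm; exact: jordan_frame_orthogonal.
have dotE x y : jdot J x y = ip x (y ∘ t).
  by rewrite /jdot trE jprodC ipA.
split; first split.
- move=> x k y z; rewrite !dotE jprodDl jprodZl (ipDr hip) (ipZr hip).
  by [].
- by move=> x y; rewrite /jdot jprodC.
- move=> x x0; have [r [lam [c [fc Ex]]]] := spectral_theorem x.
  have oc := jordan_frame_orthogonal fc.
  rewrite /jdot {1 2}Ex orthogonal_idempotents_prod // jtr_sum //.
  have sq0 i : 0 <= lam i * lam i by rewrite -expr2 sqr_ge0.
  rewrite lt_neqAle eq_sym sumr_ge0 // andbT psumr_neq0 //.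
  apply: contra_neqT x0; rewrite -all_predC => /allP H; rewrite Ex big1 // => i _.
  have := H i (mem_index_enum i); rewrite /= lt_neqAle sq0 andbT negbK eq_sym.
  by rewrite mulf_eq0 orbb => /eqP ->; rewrite scale0r.
move=> x y z; rewrite !dotE.
by rewrite ipA (jprodC J z) tcomm (jprodC J (x ∘ z)).
Qed.

End Frames.

(** * The cone of squares, the geometric mean and the Perron-Frobenius estimate *)

Section Cone.
Context (R : realType) (d : nat) (J : jordan R d).
Context (ip : 'rV[R]_d -> 'rV[R]_d -> R) (hip : inner_product ip).
Context (ipA : forall x y z, ip (jprod J x y) z = ip y (jprod J x z)).
Implicit Types (b c f u v w x y z : 'rV[R]_d).
Local Notation "x ∘ y" := (jprod J x y) (at level 40, left associativity).
Local Notation e := (jone J).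
Local Notation P := (jP J).
Local Notation K := (jcone J).

Lemma ip_normB x y : ip (x - y) (x - y) = ip x x - 2 * ip x y + ip y y.
Proof. by rewrite !(ipBl hip, ipBr hip) (ipC hip y x); ring. Qed.

Lemma ip_polar x y x' y' :
  ip (x - y) (x' + y') + ip (x + y) (x' - y') = 2 * (ip x x' - ip y y').
Proof. by rewrite !(ipBl hip, ipDl hip, ipBr hip, ipDr hip); ring. Qed.

Lemma ip_cauchy x y : ip x y ^+ 2 <= ip x x * ip y y.
Proof.
have [->|y0] := eqVneq y 0; first by rewrite !(ip0r hip) expr0n mulr0.
have yy : 0 < ip y y by case: hip => _ _; apply.
have := ip_ge0 hip (ip y y *: x - ip x y *: y).
have -> : ip (ip y y *: x - ip x y *: y) (ip y y *: x - ip x y *: y) =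
    ip y y * (ip x x * ip y y - ip x y ^+ 2).
  by rewrite !(ipBl hip, ipBr hip, ipZl hip, ipZr hip) (ipC hip y x); ring.
by rewrite pmulr_rge0 // subr_ge0.
Qed.

(** P(c) is an orthogonal projection taking c ∘ y to P(c) y, so |P(c) y| <= |c ∘ y|. Since |P(c)
    y|^2 = 2 |c ∘ y|^2 - <y, c ∘ y>, this yields |c ∘ y|^2 <= <y, c ∘ y>. *)
Lemma idempotent_psd c y : c ∘ c = c -> 0 <= ip y (c ∘ y).
Proof.
move=> cc.
have PP z : P c (P c z) = P c z.
  by have := jP_jP J c e z; rewrite jP1 cc jP_e.
have Pc : P c (c ∘ y) = P c y.
  have := jprod_op J c c c y; rewrite /jP /jL /jsq !cc => /rowP H.
  by apply/rowP => i; move: (H i); rewrite !mxE; lra.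
have normP z : ip z (P c z) = ip (P c z) (P c z) by rewrite (ip_jP hip ipA) PP.
have := ip_ge0 hip (c ∘ y - P c (c ∘ y)).
rewrite ip_normB normP Pc => H.
have E : ip y (P c y) = 2 * ip (c ∘ y) (c ∘ y) - ip y (c ∘ y).
  by rewrite /jP /jL /jsq !cc (ipBr hip) (ipZr hip) -ipA.
by move: E H (ip_ge0 hip (c ∘ y)); rewrite normP; lra.
Qed.

Lemma cone_idempotent_ge0 x c : K x -> c ∘ c = c -> 0 <= ip x c.
Proof.
by move=> [y _ <-] cc; rewrite ipA (jprodC J y c) idempotent_psd.
Qed.

Lemma cone_sum r (lam : 'I_r -> R) (c : 'I_r -> 'rV[R]_d) :
  orthogonal_idempotents J c -> (forall i, 0 <= lam i) ->
  K (\sum_i lam i *: c i).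
Proof.
move=> oc l0; exists (\sum_i Num.sqrt (lam i) *: c i) => //.
rewrite /jsq orthogonal_idempotents_prod //; apply: eq_bigr => i _.
by rewrite -expr2 sqr_sqrtr.
Qed.

Lemma ip_frame r (lam : 'I_r -> R) (c : 'I_r -> 'rV[R]_d) i :
  orthogonal_idempotents J c -> ip (\sum_i lam i *: c i) (c i) = lam i * ip (c i) (c i).
Proof.
move=> [cc co _]; rewrite (ip_suml hip) (bigD1 i) //= big1 ?addr0 ?(ipZl hip) // => j ji.
by rewrite (ipZl hip) (ip_orthogonal hip ipA (cc j)) ?mulr0 ?co.
Qed.

(** Linear inequalities make convexity of the cone immediate. For the converse, testing [x] on its
    own frame shows that its eigenvalues are nonnegative. *)
Lemma coneP x : K x <-> forall c, primitive_idempotent J c -> 0 <= ip x c.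
Proof.
split=> [Kx c cp|H]; first by apply: cone_idempotent_ge0 => //; case: cp.
have [r [lam [c [fc E]]]] := spectral_theorem hip ipA x.
have oc := jordan_frame_orthogonal fc; have [cp _ _] := fc.
rewrite E; apply: cone_sum => // i.
have := H _ (cp i); rewrite E ip_frame // pmulr_lge0 //.
by case: hip => _ _; apply; case: (cp i).
Qed.

Lemma cone_frame_ge0 r (lam : 'I_r -> R) (c : 'I_r -> 'rV[R]_d) i :
  jordan_frame J c -> K (\sum_i lam i *: c i) -> 0 <= lam i.
Proof.
move=> fc /coneP H; have [cp _ _] := fc.
have := H _ (cp i); rewrite ip_frame; last exact: jordan_frame_orthogonal.
rewrite pmulr_lge0 //; by case: hip => _ _; apply; case: (cp i).
Qed.

Lemma coneD x y : K x -> K y -> K (x + y).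
Proof.
move=> /coneP Kx /coneP Ky; apply/coneP => c cp.
by rewrite (ipDl hip) addr_ge0 ?Kx ?Ky.
Qed.

Lemma coneZ k x : 0 <= k -> K x -> K (k *: x).
Proof.
by move=> k0 /coneP Kx; apply/coneP => c cp; rewrite (ipZl hip) mulr_ge0 ?Kx.
Qed.

Lemma cone0 : K 0.
Proof. by exists 0 => //; rewrite /jsq jprod0l. Qed.

Lemma cone_ip_ge0 x y : K x -> K y -> 0 <= ip x y.
Proof.
move=> Kx; have [r [lam [c [fc ->]]]] := spectral_theorem hip ipA y.
move=> Ky; rewrite (ip_sumr hip) sumr_ge0 // => i _; rewrite (ipZr hip).
rewrite mulr_ge0 ?(cone_frame_ge0 i fc Ky) //.
by apply: cone_idempotent_ge0 => //; have [/(_ i) [] ] := fc.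
Qed.

(* By the fundamental formula the image [z] of a primitive idempotent satisfies
   [z^2 = k z] with [k >= 0]. *)
Lemma cone_jP x y : K y -> K (P x y).
Proof.
have [r [lam [c [fc ->]]]] := spectral_theorem hip ipA y.
move=> Ky; have [cp _ _] := fc; rewrite linear_sum /=.
apply: big_ind => [|u v|i _]; [exact: cone0|exact: coneD|rewrite jPZ].
apply: coneZ; first exact: cone_frame_ge0 Ky.
set z := P x (c i); have [cc c0] := primitive_idem (cp i).
have [k Ek] := primitive_jP hip ipA (x ∘ x) (cp i).
have zz : z ∘ z = k *: z by rewrite -jP1 jP_jP jP1 Ek jPZ.
have k0 : 0 <= k.
  have : 0 <= k * ip (c i) (c i).
    rewrite -(ipZl hip) -Ek (ip_jP hip ipA) jP_idem //.
    by apply: cone_idempotent_ge0 => //; exists x.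
  by rewrite pmulr_lge0 //; case: hip => _ _; apply.
have [k1|k1] := eqVneq k 0.
  suff -> : z = 0 by exact: cone0.
  by apply: (jsq_eq0 hip ipA); rewrite zz k1 scale0r.
exists ((Num.sqrt k)^-1 *: z) => //.
rewrite /jsq jprodZl jprodZr zz !scalerA -invfM -expr2 sqr_sqrtr //.
by rewrite mulVf // scale1r.
Qed.

(** Algebraic form of interiority, obtained from the topological one in [interior_cone_unit]. *)
Definition cone_unit x := exists2 k, 0 < k & K (x - k *: e).

Lemma cone_unit_cone x : cone_unit x -> K x.
Proof.
move=> [k k0 H]; rewrite -(subrK (k *: e) x); apply: coneD => //.
apply: coneZ; first exact: ltW.
by exists e => //; rewrite /jsq jprod1l.
Qed.

Lemma cone_unit_frame x r (lam : 'I_r -> R) (c : 'I_r -> 'rV[R]_d) i :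
  cone_unit x -> spectral_decomposition J x lam c -> 0 < lam i.
Proof.
move=> [k k0 H] [fc E]; move: H; have [_ _ <-] := fc.
rewrite E scaler_sumr -sumrB; under eq_bigr do rewrite -scalerBl.
by move=> /(cone_frame_ge0 i fc); rewrite subr_ge0; apply: lt_le_trans.
Qed.

Lemma cone_unitD x y : cone_unit x -> K y -> cone_unit (x + y).
Proof.
by move=> [k k0 H] Ky; exists k => //; rewrite addrAC; apply: coneD.
Qed.

Lemma cone_unitZ k x : 0 < k -> cone_unit x -> cone_unit (k *: x).
Proof.
move=> k0 [l l0 H]; exists (k * l); first exact: mulr_gt0.
by rewrite -scalerA -scalerBr; apply: coneZ => //; apply: ltW.
Qed.

(** With n the sum of the absolute eigenvalues of [v], both v and -v are at most n e, and k e <= b;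
    so t = n / k. *)
Lemma cone_unit_absorbs b v : cone_unit b -> exists t, K (t *: b - v) /\ K (t *: b + v).
Proof.
move=> [k k0 H]; have [r [lam [c [fc ->]]]] := spectral_theorem hip ipA v.
pose n := \sum_i `|lam i|; exists (n / k).
have lamn i : `|lam i| <= n.
  by rewrite /n (bigD1 i) //= lerDl sumr_ge0.
have n0 : 0 <= n by exact: sumr_ge0.
have oc := jordan_frame_orthogonal fc; have [_ _ c1] := oc.
have Hn (mu : 'I_r -> R) : (forall i, `|mu i| <= n) ->
    K ((n / k) *: b + \sum_i mu i *: c i).
  move=> mun; have -> : (n / k) *: b + \sum_i mu i *: c i =
      (n / k) *: (b - k *: e) + \sum_i (n + mu i) *: c i.
    under [in RHS]eq_bigr do rewrite scalerDl.
    rewrite big_split /= -scaler_sumr c1 scalerBr scalerA divfK ?gt_eqF //.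
    by rewrite addrA subrK.
  apply: coneD; first by apply: coneZ => //; rewrite divr_ge0 // ltW.
  apply: cone_sum => // i; have := mun i; rewrite ler_norml => /andP[].
  by rewrite -subr_ge0 opprK addrC.
split; last exact: Hn.
rewrite -sumrN; under eq_bigr do rewrite -scaleNr.
by apply: Hn => i; rewrite normrN.
Qed.

(** The fundamental formula gives P(x) P(x'^2) P(x) = P(e) = id, so P(x) is onto, and P(x) P(x')
    P(x) = P(P(x) x') = P(x). *)
Lemma jP_frameK r (s : 'I_r -> R) (c : 'I_r -> 'rV[R]_d) y :
  orthogonal_idempotents J c -> (forall i, s i != 0) ->
  P (\sum_i s i *: c i) (P (\sum_i (s i)^-1 *: c i) y) = y.
Proof.
move=> oc s0; set x := \sum_i _; set x' := \sum_i _; have [_ _ c1] := oc.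
have xx' : P x x' = x.
  rewrite orthogonal_idempotents_jP //; apply: eq_bigr => i _.
  by rewrite expr2 mulfK.
have Pxx : P x (x' ∘ x') = e.
  rewrite orthogonal_idempotents_prod // orthogonal_idempotents_jP // -c1.
  apply: eq_bigr => i _; rewrite -[RHS]scale1r; congr (_ *: _).
  by rewrite -invfM -expr2 divff // sqrf_eq0.
have {1 2}<- : P x (P (x' ∘ x') (P x y)) = y by rewrite -jP_jP Pxx jP_e.
by rewrite -jP_jP xx'.
Qed.

(** Here w = P(s) q with P(s) b = e and q^2 = P(s') y, so P(w) = P(s) P(q) P(s) takes b to y. The
    inverse is given as a product of three quadratic representations so that it visibly preserves
    the cone. *)
Lemma gmean_properties b y : cone_unit b -> cone_unit y ->
  let w := jgmean J (jinv J b) y in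
  [/\ P w b = y, K w & exists x1 x2 x3, forall v,
    P w (P x1 (P x2 (P x3 v))) = v /\ P x1 (P x2 (P x3 (P w v))) = v].
Proof.
move=> ub uy w.
have [r [be [c [fc Eb]]]] := spectral_theorem hip ipA b.
have oc := jordan_frame_orthogonal fc.
have be0 i : 0 < be i by exact: cone_unit_frame ub (conj fc Eb).
have invE : jinv J b = \sum_i (be i)^-1 *: c i.
  by rewrite /jinv (jfunE _ (conj fc Eb)).
pose si i := Num.sqrt (be i)^-1.
have si0 i : 0 < si i by rewrite sqrtr_gt0 invr_gt0.
set s := \sum_i si i *: c i; set s' := \sum_i (si i)^-1 *: c i.
have sE : jsqrt J (jinv J b) = s by rewrite /jsqrt (jfunE _ (conj fc invE)).
have s'E : jinvsqrt J (jinv J b) = s'.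
  by rewrite /jinvsqrt (jfunE _ (conj fc invE)).
have ss' v : P s (P s' v) = v.
  by apply: jP_frameK => // i; rewrite gt_eqF.
have s's v : P s' (P s v) = v.
  rewrite -[in LHS](_ : \sum_i ((si i)^-1)^-1 *: c i = s).
    by apply: jP_frameK => // i; rewrite invr_eq0 gt_eqF.
  by apply: eq_bigr => i _; rewrite invrK.
have sb : P s b = e.
  rewrite Eb orthogonal_idempotents_jP //; case: oc => _ _ <-.
  apply: eq_bigr => i _; rewrite sqr_sqrtr ?invr_ge0 ?ltW // mulVf ?scale1r //.
  by rewrite gt_eqF.
(* P(s') y dominates P(s') (k e) = k b. *)
have uy' : cone_unit (P s' y).
  have [k k0 H] := uy.
  rewrite -(subrK (P s' (k *: e)) (P s' y)) -jPB addrC.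
  apply: cone_unitD; last exact: cone_jP.
  by rewrite jPZ; apply: cone_unitZ => //; rewrite -sb s's.
have [n [mu [f [ff Ey]]]] := spectral_theorem hip ipA (P s' y).
have of' := jordan_frame_orthogonal ff.
have mu0 i : 0 < mu i by exact: cone_unit_frame uy' (conj ff Ey).
pose ta i := Num.sqrt (mu i).
have ta0 i : 0 < ta i by rewrite sqrtr_gt0.
set q := \sum_i ta i *: f i; set q' := \sum_i (ta i)^-1 *: f i.
have qE : jsqrt J (P s' y) = q by rewrite /jsqrt (jfunE _ (conj ff Ey)).
have wE : w = P s q by rewrite /w /jgmean sE s'E qE.
have qq' v : P q (P q' v) = v.
  by apply: jP_frameK => // i; rewrite gt_eqF.
have q'q v : P q' (P q v) = v.
  rewrite -[in LHS](_ : \sum_i ((ta i)^-1)^-1 *: f i = q).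
    by apply: jP_frameK => // i; rewrite invr_eq0 gt_eqF.
  by apply: eq_bigr => i _; rewrite invrK.
split.
- rewrite wE jP_jP sb jP1 orthogonal_idempotents_prod // -[RHS]ss' Ey.
  congr (P s _); apply: eq_bigr => i _; rewrite -expr2 sqr_sqrtr // ltW //.
- by rewrite wE; apply: cone_jP; apply: cone_sum => // i; exact: ltW.
- exists s', q', s' => v; rewrite wE !jP_jP.
  by rewrite s's q'q s's ss' qq' ss'.
Qed.

Lemma iter_linear (T : {linear 'rV[R]_d -> 'rV[R]_d}) n u v :
  iter n T (u + v) = iter n T u + iter n T v /\
  iter n T (u - v) = iter n T u - iter n T v.
Proof. by elim: n => //= n [-> ->]; rewrite linearD linearB. Qed.

(* Spectral radius estimate: [T] is self-adjoint for a positive semidefinite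
   form, so the values at the powers [T ^ (2 ^ k)] grow at least like repeated
   squares, by Cauchy-Schwarz. *)
Lemma selfadjoint_bounded_powers (B : 'rV[R]_d -> 'rV[R]_d -> R)
    (T : 'rV[R]_d -> 'rV[R]_d) v M :
  (forall x y, B x y ^+ 2 <= B x x * B y y) -> 0 <= B v v ->
  (forall x y, B (T x) y = B x (T y)) ->
  (forall n, B v (iter n T v) <= M) -> B v (T v) <= B v v.
Proof.
move=> cs N0 sa bd; set N := B v v in N0 *.
have saN n x y : B (iter n T x) y = B x (iter n T y).
  by elim: n x y => //= n IH x y; rewrite sa IH -iterSr.
pose m k := B v (iter (2 ^ k) T v).
have mS k : m k ^+ 2 <= N * m k.+1.
  rewrite /m expnS mul2n -addnn iterD -[leRHS]/(_ * B _ (iter _ T _)) -[in leRHS]saN.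
  exact: cs.
have [N00|Npos] := eqVneq N 0.
  have := mS 0%N; rewrite N00 mul0r /m expn0 /= => H.
  have /eqP : B v (T v) ^+ 2 == 0 by rewrite eq_le H sqr_ge0.
  by move=> /eqP; rewrite sqrf_eq0 => /eqP ->.
have Np : 0 < N by rewrite lt_neqAle eq_sym Npos.
rewrite leNgt; apply/negP => gt1.
pose dl := B v (T v) / N - 1.
(* If B v (T v) exceeded N, the ratios m k / N would start at 1 + dl and at least square at each
   step. A linear lower bound survives squaring and already contradicts boundedness. *)
have dl0 : 0 < dl by rewrite subr_gt0 ltr_pdivlMr // mul1r.
have grow k : 1 + k.+1%:R * dl <= m k / N.
  elim: k => [|k IH]; first by rewrite mul1r /dl addrC subrK /m expn0.
  have p0 : 0 <= 1 + k.+1%:R * dl by rewrite addr_ge0 // mulr_ge0 // ltW.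
  have H : (1 + k.+1%:R * dl) ^+ 2 <= (m k / N) ^+ 2.
    by rewrite lerXn2r ?nnegrE // (le_trans p0 IH).
  have H2 : (m k / N) ^+ 2 <= m k.+1 / N.
    by rewrite expr_div_n ler_pdivrMr ?exprn_gt0 // [N ^+ 2]expr2 mulrA divfK // mulrC.
  apply: le_trans (le_trans H H2).
  rewrite -natr1; have : 0 <= k%:R * dl by rewrite mulr_ge0 // ltW.
  have -> : k.+1%:R = k%:R + 1 :> R by rewrite natr1.
  move: (sqr_ge0 ((k%:R + 1) * dl)); move: dl0; nra.
have [k kM] : exists k : nat, M / N < 1 + k.+1%:R * dl.
  exists (Num.bound `|M / N / dl|).
  have : M / N / dl < (Num.bound `|M / N / dl|)%:R.
    exact: le_lt_trans (ler_norm _) (archi_boundP (normr_ge0 _)).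
  rewrite ltr_pdivrMr // -natr1 => H; apply: (lt_trans H).
  by rewrite mulrDl mul1r addrA addrC addrA ltrDr addr_gt0.
have := lt_le_trans kM (grow k).
by rewrite ltr_pM2r ?invr_gt0 // ltNge bd.
Qed.

Lemma perron_majorant (G : {linear 'rV[R]_d -> 'rV[R]_d}) b w x1 x2 x3 :
  (forall x, K x -> K (G x)) -> (forall x y, ip (G x) y = ip x (G y)) ->
  cone_unit b -> P w b = G b -> K w ->
  (forall v, P w (P x1 (P x2 (P x3 v))) = v /\ P x1 (P x2 (P x3 (P w v))) = v) ->
  forall v, ip v (G v) <= ip v (P w v).
Proof.
move=> KG symG ub wb Kw inv v.
pose T := (jP J x1 \o (jP J x2 \o (jP J x3 \o G))) : {linear 'rV[R]_d -> 'rV[R]_d}.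
pose B x y := ip x (P w y).
have wT x : P w (T x) = G x by rewrite /T /=; have [] := inv (G x).
have Tb : T b = b by rewrite /T /= -wb; have [] := inv b.
have KT n x : K x -> K (iter n T x).
  by move=> Kx; elim: n => //= n IH; do 3!apply: cone_jP; apply: KG.
(* Since w = z^2 = P(z) e, P(w) = P(z) P(z), so [B] is positive semidefinite. *)
have [z _ zw] := Kw.
have BE x y : B x y = ip (P z x) (P z y).
  rewrite /B -zw /jsq -(jP1 J z).
  by rewrite jP_jP jP_e (ip_jP hip ipA).
have sa x y : B (T x) y = B x (T y).
  by rewrite /B -(ip_jP hip ipA) !wT symG.
have := @selfadjoint_bounded_powers B T v; rewrite /B wT.
have [t [Km Kp]] := cone_unit_absorbs v ub.
move=> /(_ (B (t *: b) (t *: b))); apply.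
- by move=> x y; rewrite -!/(B _ _) !BE ip_cauchy.
- by rewrite -/(B _ _) BE ip_ge0.
- exact: sa.
move=> n; rewrite -!/(B _ _); set u := t *: b in Km Kp *.
have Tu : iter n T u = u.
  have TZ k y : T (k *: y) = k *: T y by exact: linearZ.
  by elim: n => // n IH; rewrite iterS IH TZ Tb.
have [I1 I2] := iter_linear T n u v.
have H1 : 0 <= B (u - v) (iter n T (u + v)).
  by apply: cone_ip_ge0 => //; apply: cone_jP; apply: KT.
have H2 : 0 <= B (u + v) (iter n T (u - v)).
  by apply: cone_ip_ge0 => //; apply: cone_jP; apply: KT.
(* As [T] fixes [u], [H1] and [H2] add up to 2 (B u u - B v (T^n v)) >= 0, a bound independent of
   n. *)
have := ip_polar u v (P w u) (P w (iter n T v)).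
move: H1 H2; rewrite I1 I2 Tu /B jPD jPB.
lra.
Qed.

End Cone.

(** * Differentials of linear forms and of finite sums *)

Section LinearFormDifferential.
Context (R : realType) (d : nat).

Lemma is_diff_scalar (f : 'rV[R]_d -> R) (b : 'rV[R]_d) :
  scalar f -> is_diff b f f.
Proof.
move=> flin.
pose fM := GRing.isLinear.Build R 'rV[R]_d R _ f flin.
pose fL : {linear 'rV[R]_d -> R} := HB.pack f fM.
(* The coordinate expansion supplies the continuity of [f]. *)
have fE : f = \sum_(j < d) f (delta_mx 0 j) *: (fun y : 'rV[R]_d => y 0 j).
  apply/funext => y; rewrite fct_sumE {1}[y]row_sum_delta -[LHS]/(fL _) linear_sum.
  by apply: eq_bigr => j _; rewrite linearZ; exact: mulrC.
have fc : continuous f.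
  move=> y; apply: differentiable_continuous; rewrite fE.
  apply: differentiable_sum => j; apply: differentiableZ.
  exact: differentiable_coord.
apply: DiffDef; first exact: (linear_differentiable (f := fL)).
exact: (diff_lin (f := fL)).
Qed.

Lemma is_diff_sum (I : Type) (r : seq I) (b : 'rV[R]_d) (f df : I -> 'rV[R]_d -> R) :
  (forall i, is_diff b (f i) (df i)) ->
  is_diff b (\sum_(i <- r) f i) (\sum_(i <- r) df i).
Proof.
move=> fdf; apply: (big_ind2 (fun F G => is_diff b F G)) => //.
  exact: is_diff_cst.
by move=> F1 G1 F2 G2 H1 H2; apply: is_diffD.
Qed.

End LinearFormDifferential.

(** * The least-squares function and its majorant *)

Section LeastSquaresDescent.
Context (R : realType) (d m : nat) (J : jordan R d) (hJ : euclidean J).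
Context (a : 'I_m -> 'rV[R]_d) (x : 'rV[R]_m).
Implicit Types (b v w : 'rV[R]_d).

Let hip : inner_product (jdot J).
Proof. by case: hJ => ip ip1 ip2; have [] := jdot_euclidean ip1 ip2. Qed.

Let ipA : forall u v w, jdot J (jprod J u v) w = jdot J v (jprod J u w).
Proof. by case: hJ => ip ip1 ip2; have [] := jdot_euclidean ip1 ip2. Qed.

Lemma adjoint_meas (y : 'rV[R]_m) :
  adjoint J (meas J a) y = \sum_i y 0 i *: a i.
Proof.
have dotE v : dotv (meas J a v) y = jdot J v (\sum_i y 0 i *: a i).
  rewrite (ip_sumr hip); apply: eq_bigr => i _.
  by rewrite mxE (ipZr hip) mulrC (ipC hip).
apply: xget_unique => // w wE; apply: (ip_inj hip) => v.
by rewrite !(ipC hip _ v) -wE -dotE.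
Qed.

Lemma gram_sum b : gram J a b = \sum_i jdot J (a i) b *: a i.
Proof. by rewrite /gram adjoint_meas; apply: eq_bigr => i _; rewrite mxE. Qed.

Lemma gradient_lsq b :
  gradient J (lsq J a x) b = \sum_i (meas J a b - x) 0 i *: a i.
Proof.
set g := \sum_i _.
have dg : is_diff b (lsq J a x) (fun v => jdot J g v).
  pose phi i : 'rV[R]_d -> R := jdot J (a i) - cst (x 0 i).
  have -> : lsq J a x = 2^-1 *: \sum_i phi i ^+ 2.
    apply/funext => y; rewrite /lsq /dotv /= scalrfctE fct_sumE; congr (_ * _).
    by apply: eq_bigr => i _; rewrite !mxE exprfctE expr2.
  have dphi i : is_diff b (phi i) (jdot J (a i) - 0).
    by apply: is_diffB; apply: is_diff_scalar; case: hip.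
  have dphi2 i := is_diffX 1 (dphi i).
  apply: is_diff_eq (is_diffZ 2^-1 (is_diff_sum _ dphi2)) _.
  apply/funext => v; rewrite scalrfctE fct_sumE scaler_sumr (ip_suml hip).
  apply: eq_bigr => i _; rewrite (ipZl hip) scalrfctE subr0 !mxE.
  by rewrite /phi /= expr1 scalerA mulrA mulVf // mul1r.
apply: xget_unique => // g' dg'; apply: (ip_inj hip) => v.
have E h : is_diff b (lsq J a x) h -> 'd (lsq J a x) b v = h v.
  by move=> dh; rewrite diff_val.
by rewrite -(E _ dg) (E _ dg').
Qed.

Lemma gram_meas v : jdot J v (gram J a v) = dotv (meas J a v) (meas J a v).
Proof.
rewrite gram_sum (ip_sumr hip); apply: eq_bigr => i _.
by rewrite mxE (ipZr hip) (ipC hip v).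
Qed.

(** A quadratic function equals its second-order expansion, so the majorization reduces to comparing
    quadratic terms. *)
Lemma lsq_expansion bk b : lsq J a x b = lsq J a x bk
  + jdot J (b - bk) (gradient J (lsq J a x) bk)
  + 2^-1 * jdot J (b - bk) (gram J a (b - bk)).
Proof.
rewrite gradient_lsq gram_meas (ip_sumr hip) /lsq /dotv.
rewrite !mulr_sumr -!big_split /=; apply: eq_bigr => i _.
rewrite (ipZr hip) (ipC hip (b - bk)) !mxE (ipBr hip).
by field.
Qed.

Lemma interior_cone_unit b : interior (jcone J) b -> cone_unit J b.
Proof.
(* This [k] puts b - k e in the ball; the added 1 keeps the denominator positive even when e = 0. *)
move=> /nbhs_ballP [eps /= eps0 sub]; pose k := eps / 2 / (1 + `|jone J|).
have n1 : 0 < 1 + `|jone J| by rewrite ltr_pwDl.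
have k0 : 0 < k by rewrite !divr_gt0.
exists k => //; apply: sub; rewrite -ball_normE /ball_ /= opprB addrC subrK.
rewrite normrZ gtr0_norm // /k mulrAC ltr_pdivrMr //.
have := mulr_ge0 (ltW eps0) (normr_ge0 (jone J)); move: eps0; nra.
Qed.

(** A zero unit forces u = e ∘ u = 0. This case is separate because strict positivity in
    [cone_unit_dot_gt0] fails there. *)
Lemma cone_unit_unit0 u : jone J = 0 -> cone_unit J u.
Proof.
move=> e0; exists 1 => //; rewrite -(jprod1l J u) e0 jprod0l scaler0 subr0.
exact: cone0.
Qed.

(** From v >= l e and u >= k e, <u, v> >= l <u, e> >= l k <e, e> > 0. *)
Lemma cone_unit_dot_gt0 u v : jone J != 0 -> cone_unit J u -> cone_unit J v ->
  0 < jdot J u v.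
Proof.
move=> e0 uu [l l0 Kv].
have ee : 0 < jdot J (jone J) (jone J) by case: hip => _ _; apply.
have [k k0 Ku] := uu.
have Ke : jcone J (jone J) by exists (jone J) => //; rewrite /jsq jprod1l.
have ue : 0 < jdot J u (jone J).
  rewrite -(subrK (k *: jone J) u) (ipDl hip) (ipZl hip).
  by rewrite ltr_wpDl ?(cone_ip_ge0 hip ipA) // mulr_gt0.
rewrite -(subrK (l *: jone J) v) (ipDr hip) (ipZr hip).
rewrite ltr_wpDl ?(cone_ip_ge0 hip ipA) // ?mulr_gt0 //.
exact: (cone_unit_cone hip ipA).
Qed.

Lemma gram_cone b : (forall i, jcone J (a i)) -> jcone J b -> jcone J (gram J a b).
Proof.
move=> Ka Kb; rewrite gram_sum; apply: big_ind => [|u v|i _].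
- exact: cone0.
- exact: (coneD hip ipA).
- by apply: (coneZ hip ipA) => //; apply: (cone_ip_ge0 hip ipA).
Qed.

Lemma gram_cone_unit b : (0 < m)%N -> (forall i, cone_unit J (a i)) ->
  cone_unit J b -> cone_unit J (gram J a b).
Proof.
move=> m0 ua ub; have [e0|e0] := eqVneq (jone J) 0; first exact: cone_unit_unit0.
have Kb := cone_unit_cone hip ipA ub.
have Ka i : jcone J (a i) by exact: (cone_unit_cone hip ipA).
(* One interior summand is enough, the others lying in the cone; m >= 1 provides index 0. *)
rewrite gram_sum (bigD1 (Ordinal m0)) //=; apply: (cone_unitD hip ipA).
  by apply: (cone_unitZ hip ipA) => //; exact: cone_unit_dot_gt0.
apply: big_ind => [|u v|i _]; [exact: cone0|exact: (coneD hip ipA)|].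
by apply: (coneZ hip ipA) => //; apply: (cone_ip_ge0 hip ipA).
Qed.

Lemma gram_linear : linear (gram J a).
Proof.
move=> k u v; rewrite !gram_sum scaler_sumr -big_split /=; apply: eq_bigr => i _.
by rewrite (ipDr hip) (ipZr hip) scalerDl scalerA.
Qed.

Lemma gram_sym u v : jdot J (gram J a u) v = jdot J u (gram J a v).
Proof.
rewrite !gram_sum (ip_suml hip) (ip_sumr hip); apply: eq_bigr => i _.
by rewrite (ipZl hip) (ipZr hip) mulrC (ipC hip u).
Qed.

Lemma gram_majorized b : (0 < m)%N -> (forall i, cone_unit J (a i)) ->
  cone_unit J b ->
  loewner_le J (gram J a) (jP J (jgmean J (jinv J b) (gram J a b))).
Proof.
move=> m0 ua ub v; have ug := gram_cone_unit m0 ua ub.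
pose GM := GRing.isLinear.Build R 'rV[R]_d 'rV[R]_d _ (gram J a) gram_linear.
pose G : {linear 'rV[R]_d -> 'rV[R]_d} := HB.pack (gram J a) GM.
have [wb Kw [x1 [x2 [x3 inv]]]] := gmean_properties hip ipA ub ug.
apply: (perron_majorant hip ipA (G := G) _ gram_sym ub wb Kw inv).
by move=> y; apply: gram_cone => i; exact: (cone_unit_cone hip ipA).
Qed.

End LeastSquaresDescent.

Unset Implicit Arguments.

Theorem theorem4p1 (R : realType) (d m : nat) (J : jordan R d)
    (hJ : euclidean J) (hm : (1 <= m)%N)
    (bk : 'rV[R]_d) (hbk : interior (jcone J) bk)
    (a : 'I_m -> 'rV[R]_d) (ha : forall i, interior (jcone J) (a i))
    (x : 'rV[R]_m) :
  loewner_le J (gram J a) (jP J (jgmean J (jinv J bk) (gram J a bk))) /\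
  (forall b : 'rV[R]_d, lsq J a x b <= lsq_majorant J a x bk b).
Proof.
have maj : loewner_le J (gram J a) (jP J (jgmean J (jinv J bk) (gram J a bk))).
  by apply: gram_majorized => // [i|]; apply: interior_cone_unit.
split=> // b; rewrite (lsq_expansion hJ a x bk) /lsq_majorant lerD2l.
by rewrite ler_pM2l ?invr_gt0.
Qed.
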